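(* Let $k\ge1$, let $A\in\mathbb{C}^{(2k+1)\times(2k+1)}$ be similar to $J_{2k+1}(\lambda_0)$, and let $\{u_i\}_{i=1}^{2k+1}$ and $\{v_i\}_{i=1}^{2k+1}$ be left and right Jordan chains of $A$ for $\lambda_0$. Put $U=\begin{bmatrix}u_1&\cdots&u_k\end{bmatrix}$, $V=\begin{bmatrix}v_1&\cdots&v_k\end{bmatrix}$ and $r=\dfrac{u_{k+1}}{v_{k+1}^*u_{k+1}}$, let $R,L\in\mathbb{C}^{(2k+1)\times k}$ satisfy $R^*V=U^*L=I_k$, let $\lambda_1\in\mathbb{C}$, and define $$\widehat{A}=A+(\lambda_1-\lambda_0)(VR^*+v_{k+1}r^*+LU^* ).$$ Then the Jordan canonical form of $\widehat{A}$ is one of the following types: $J_{2k+1}(\lambda_1)$; $J_{2k-i+1}(\lambda_1)\oplus J_i(\lambda_1)$ for some $1\le i\le k$; or $J_{2k-i}(\lambda_1)\oplus J_i(\lambda_1)\oplus J_1(\lambda_1)$ for some $1\le i\le k$.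
   Context: $^*$ denotes conjugate transpose. $J_m(\lambda)$ is the $m\times m$ Jordan block with $\lambda$ on the diagonal and $1$ on the superdiagonal; $\oplus$ is the block-diagonal direct sum. A right Jordan chain $\{v_i\}_{i=1}^{m}$ of $A$ for $\lambda_0$ satisfies $v_1\neq0$, $Av_1=\lambda_0v_1$ and $Av_{i+1}=\lambda_0v_{i+1}+v_i$ for $1\le i<m$. A left Jordan chain $\{u_i\}_{i=1}^{m}$ satisfies $u_1\ne0$, $u_1^*A=\lambda_0u_1^*$ and $u_{i+1}^*A=\lambda_0u_{i+1}^*+u_i^*$ for $1\le i<m$. Under the stated hypotheses $v_{k+1}^*u_{k+1}\neq0$, so $r$ is well defined. *)

(* Defs.v *)
From mathcomp Require Export all_boot all_order all_algebra.
From mathcomp Require Export reals complex.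

Set Implicit Arguments.
Unset Strict Implicit.
Unset Printing Implicit Defensive.

Import GRing.Theory Num.Theory.

Local Open Scope ring_scope.
Local Open Scope sesquilinear_scope.

Definition jordan_block (F : fieldType) (m : nat) (lambda : F) : 'M[F]_m :=
  \matrix_(i < m, j < m)
    if i == j then lambda else if i.+1 == j :> nat then 1 else 0.

Definition direct_sum_mx (F : fieldType) (m n : nat)
    (A : 'M[F]_m) (B : 'M[F]_n) : 'M[F]_(m + n) :=
  block_mx A 0 0 B.

(* The cast is there because the size of B (e.g. a sum of block sizes) may be
   only provably, not definitionally, equal to the size of A. *)
Definition is_similar_mx (F : fieldType) (n m : nat)
    (A : 'M[F]_n) (B : 'M[F]_m) : Prop :=
  exists e : m = n, similar_in unitmx A (castmx (e, e) B).

(* Chains are indexed from 1: only the values v 1, ..., v m matter. *)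
Definition right_jordan_chain (C : numClosedFieldType) (n : nat)
    (A : 'M[C]_n) (lambda : C) (m : nat) (v : nat -> 'cV[C]_n) : Prop :=
  [/\ v 1%N != 0,
      A *m v 1%N = lambda *: v 1%N
    & forall i : nat, (1 <= i < m)%N ->
        A *m v i.+1 = lambda *: v i.+1 + v i].

Definition left_jordan_chain (C : numClosedFieldType) (n : nat)
    (A : 'M[C]_n) (lambda : C) (m : nat) (u : nat -> 'cV[C]_n) : Prop :=
  [/\ u 1%N != 0,
      (u 1%N)^t* *m A = lambda *: (u 1%N)^t*
    & forall i : nat, (1 <= i < m)%N ->
        (u i.+1)^t* *m A = lambda *: (u i.+1)^t* + (u i)^t*].

(* The n x k matrix with columns w 1, ..., w k. *)
Definition mx_of_columns (F : fieldType) (n : nat) (k : nat)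
    (w : nat -> 'cV[F]_n) : 'M[F]_(n, k) :=
  \matrix_(i < n, j < k) w j.+1 i 0.

(* Main.v *)
(* [M = Ahat - lambda1] is block upper triangular with diagonal blocks
   [N], [0], [N^T], where [N] is the nilpotent Jordan block of size [k]: the
   span of [v_1 .. v_k] and the annihilator of [u_1 .. u_k] are invariant, since
   [u_i^* v_j = 0] for [i + j <= 2k + 1].  Hence [M] is nilpotent of rank at
   least [2k - 2], i.e. has at most three Jordan blocks.  If the rank is exactly
   [2k - 2], then [v_{k+1}] can be corrected by a combination of [v_1 .. v_k] to
   a kernel vector [w], and [r^*] by a combination of the [u_i^*] to a left
   kernel vector [f]; as [f w = 1], the kernel of [M] is not contained in its
   image, so the smallest block has size 1. *)

Require Import Defs.
From mathcomp Require Import all_boot all_order all_algebra.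
From mathcomp Require Import reals complex.
From mathcomp Require Import zify.

Set Implicit Arguments.
Unset Strict Implicit.
Unset Printing Implicit Defensive.

Import GRing.Theory Num.Theory.

Local Open Scope ring_scope.
Local Open Scope sesquilinear_scope.
Local Open Scope complex_scope.

(** * Nilpotent Jordan blocks *)

Section JordanBlock.
Variable F : fieldType.

Local Notation J m := (jordan_block m (0 : F)).

Lemma jordan_blockE m (a : F) : jordan_block m a = J m + a%:M.
Proof.
apply/matrixP => i j; rewrite !mxE.
by case: (i =P j) => _; rewrite ?add0r ?addr0.
Qed.

Lemma jordan_block0E m (i j : 'I_m) : J m i j = (i.+1 == j)%:R.
Proof.
rewrite !mxE; case: (i =P j) => [->|_]; last by case: eqP.
by rewrite gtn_eqF.
Qed.

Lemma mulmx_jordan0_first q m (B : 'M[F]_(q, m)) i (j : 'I_m) :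
  j = 0%N :> nat -> (B *m J m) i j = 0.
Proof.
by move=> j0; rewrite mxE big1 // => l _; rewrite jordan_block0E j0 mulr0.
Qed.

Lemma mulmx_jordan0_succ q m (B : 'M[F]_(q, m)) i (l j : 'I_m) :
  j = l.+1 :> nat -> (B *m J m) i j = B i l.
Proof.
move=> jl; rewrite mxE (bigD1 l) //= big1 ?addr0.
  by rewrite jordan_block0E jl eqxx mulr1.
move=> a /negPf al; rewrite jordan_block0E jl eqSS.
by move: al; rewrite -val_eqE /= => ->; rewrite mulr0.
Qed.

Lemma mul_jordan0mx_last q m (B : 'M[F]_(m, q)) (i : 'I_m) j :
  i.+1 = m -> (J m *m B) i j = 0.
Proof.
move=> im; rewrite mxE big1 // => l _; rewrite jordan_block0E im.
by rewrite gtn_eqF ?mul0r.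
Qed.

Lemma mul_jordan0mx_pred q m (B : 'M[F]_(m, q)) (i l : 'I_m) j :
  l = i.+1 :> nat -> (J m *m B) i j = B l j.
Proof.
move=> li; rewrite mxE (bigD1 l) //= big1 ?addr0.
  by rewrite jordan_block0E li eqxx mul1r.
move=> a /negPf al; rewrite jordan_block0E -li eq_sym.
by move: al; rewrite -val_eqE /= => ->; rewrite mul0r.
Qed.

Lemma jordan_block0X m p (i j : 'I_m) : (J m ^+ p) i j = (i + p == j)%N%:R.
Proof.
elim: p j => [|p IHp] j.
  by rewrite expr0 addn0 mxE val_eqE.
rewrite exprSr -[_ * _]/(_ *m _) addnS.
case: j => [[|j] jm] /=; first by rewrite mulmx_jordan0_first.
by rewrite (@mulmx_jordan0_succ _ _ _ _ (Ordinal (ltnW jm))) // IHp eqSS.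
Qed.

Lemma jordan_block0_nilp m : J m ^+ m = 0.
Proof.
apply/matrixP => i j; rewrite jordan_block0X mxE gtn_eqF //.
exact: leq_trans (ltn_ord j) (leq_addl _ _).
Qed.

Lemma exprmx_intertwine n m (A : 'M[F]_n) (B : 'M[F]_m) (P : 'M[F]_(n, m)) s :
  A *m P = P *m B -> A ^+ s *m P = P *m B ^+ s.
Proof.
move=> AP; elim: s => [|s IHs]; first by rewrite !expr0 mul1mx mulmx1.
rewrite !exprS -[A * _]/(A *m _) -[B * _]/(B *m _).
by rewrite -mulmxA IHs !mulmxA AP.
Qed.

Lemma exprmx_comm n (A : 'M[F]_n) s : A *m A ^+ s = A ^+ s *m A.
Proof.
by rewrite -[LHS]/(A * A ^+ s) -[RHS]/(A ^+ s * A) -exprS exprSr.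
Qed.

(** A right inverse [B] of [A] would give [A ^+ s *m B ^+ s = 1%:M] by cancelling from the
    middle. *)
Lemma rank_nilp n (A : 'M[F]_n) s : (0 < n)%N -> A ^+ s = 0 ->
  (\rank A < n)%N.
Proof.
move=> n0 As; rewrite ltn_neqAle rank_leq_row andbT; apply/negP => rA.
have /row_freeP[B AB] : row_free A by [].
suff : (1%:M : 'M[F]_n) = 0.
  by move/matrixP/(_ (Ordinal n0) (Ordinal n0))/eqP; rewrite !mxE eqxx oner_eq0.
have -> : (1%:M : 'M[F]_n) = A ^+ s *m B ^+ s; last by rewrite As mul0mx.
elim: s {As} => [|s IHs]; first by rewrite !expr0 mul1mx.
rewrite exprSr [B ^+ _]exprS -[_ * A]/(_ *m A) -[B * _]/(B *m _).
by rewrite mulmxA -(mulmxA _ A) AB mulmx1.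
Qed.

Lemma rank_jordan0 m : (0 < m)%N -> \rank (J m) = m.-1.
Proof.
move=> m0; apply/eqP; rewrite eqn_leq; apply/andP; split.
  by rewrite -ltnS prednK //; apply: rank_nilp m0 (jordan_block0_nilp m).
case: m {m0} => //= m.
(* [E1] selects the first [m] rows and [E2] the last [m] columns; this cuts the superdiagonal out as
   an identity matrix. *)
pose E1 : 'M[F]_(m, m.+1) := \matrix_(i, j) (i == j :> nat)%:R.
pose E2 : 'M[F]_(m.+1, m) := \matrix_(i, j) (i == j.+1 :> nat)%:R.
apply: (@mulmx1_min_rank _ m _ _ _ E1 E2).
apply/matrixP => i j; rewrite !mxE (bigD1 (lift ord0 j)) //= big1 ?addr0.
  rewrite [E2 _ _]mxE /= eqxx mulr1.
  by rewrite (@mulmx_jordan0_succ _ _ _ _ (widen_ord (leqnSn m) j)) // mxE.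
move=> l /negPf lj; rewrite [E2 _ _]mxE.
by move: lj; rewrite -val_eqE /= /bump /= add1n => ->; rewrite mulr0.
Qed.

(* The columns of [V] form a Jordan chain of [M], and the rows [f M^i] are
   triangular against it. *)
Lemma jordan_chain_unit n m (M : 'M[F]_n) (V : 'M[F]_(n, m)) (f : 'rV[F]_n)
    (i0 : 'I_m) :
  M *m V = V *m J m -> i0 = 0%N :> nat -> (f *m V) 0 i0 = 1 ->
  (\matrix_(i < m) (f *m M ^+ i)) *m V \in unitmx.
Proof.
move=> MV i00 fV; set G := _ *m V.
have GE i j : G i j = \sum_l (f *m V) 0 l * (l + i == j)%N%:R.
  have -> : G i j = (f *m M ^+ i *m V) 0 j.
    by rewrite -[f *m _](rowK (fun i : 'I_m => f *m M ^+ i)) -row_mul [RHS]mxE.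
  rewrite -mulmxA (exprmx_intertwine _ MV) mulmxA mxE.
  by apply: eq_bigr => l _; rewrite jordan_block0X.
(* [G] is upper triangular with the entry [(f *m V) 0 i0 = 1] all along its diagonal; the transpose
   makes it lower triangular, as [det_trig] expects. *)
rewrite -unitmx_tr unitmxE det_trig.
  rewrite big1 ?unitr1 // => i _; rewrite mxE GE (bigD1 i0) //= big1 ?addr0.
    by rewrite i00 add0n eqxx mulr1.
  move=> l /negPf li; rewrite -[X in (_ == X)%N]add0n eqn_add2r.
  by move: li; rewrite -val_eqE /= i00 => ->; rewrite mulr0.
apply/is_trig_mxP => i j ij; rewrite mxE GE big1 // => l _.
by rewrite gtn_eqF ?mulr0 //; apply: leq_trans ij (leq_addl _ _).
Qed.

End JordanBlock.

(** * Similarity and splitting of nilpotent matrices *)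

Section Similarity.
Variable F : fieldType.

Local Notation J m := (jordan_block m (0 : F)).

(* Rectangular base change: unlike [is_similar_mx] it needs no cast, so the
   sizes may stay syntactically different. *)
Definition mx_sim n m (A : 'M[F]_n) (B : 'M[F]_m) : Prop :=
  exists P : 'M_(n, m), exists Q : 'M_(m, n),
    [/\ P *m Q = 1%:M, Q *m P = 1%:M & A *m P = P *m B].

Lemma mx_sim_refl n (A : 'M[F]_n) : mx_sim A A.
Proof. by exists 1%:M, 1%:M; rewrite !mulmx1 mul1mx. Qed.

Lemma mx_sim_trans n m p (A : 'M[F]_n) (B : 'M[F]_m) (C : 'M[F]_p) :
  mx_sim A B -> mx_sim B C -> mx_sim A C.
Proof.
move=> [P [Q [PQ QP AP]]] [S [T [ST TS BS]]].
exists (P *m S), (T *m Q); split.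
- by rewrite mulmxA -(mulmxA P) ST mulmx1.
- by rewrite mulmxA -(mulmxA T) QP mulmx1.
- by rewrite mulmxA AP -mulmxA BS mulmxA.
Qed.

Lemma mx_sim_dim n m (A : 'M[F]_n) (B : 'M[F]_m) : mx_sim A B -> m = n.
Proof.
by move=> [P [Q [PQ QP _]]]; apply/eqP; rewrite eqn_leq (mulmx1_min PQ)
  (mulmx1_min QP).
Qed.

Lemma mx_sim_is_similar n m (A : 'M[F]_n) (B : 'M[F]_m) :
  mx_sim A B -> is_similar_mx A B.
Proof.
move=> AB; have e := mx_sim_dim AB; case: n / e A AB => A.
move=> [P [Q [PQ QP AP]]]; exists erefl; rewrite castmx_id.
have [_ Qu] := mulmx1_unit PQ.
by exists Q => //; apply/similarP; rewrite // -[LHS]mulmx1 -PQ mulmxA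
  -(mulmxA Q) AP mulmxA QP mul1mx.
Qed.

Lemma mx_sim_cast n m (A : 'M[F]_n) (e : n = m) : mx_sim (castmx (e, e) A) A.
Proof. by case: m / e; rewrite castmx_id; apply: mx_sim_refl. Qed.

Lemma mx_sim_addM n m (A : 'M[F]_n) (B : 'M[F]_m) a :
  mx_sim A B -> mx_sim (A + a%:M) (B + a%:M).
Proof.
move=> [P [Q [PQ QP AP]]]; exists P, Q; split=> //.
by rewrite mulmxDl mulmxDr AP scalar_mxC.
Qed.

Lemma mx_sim_rank n m (A : 'M[F]_n) (B : 'M[F]_m) :
  mx_sim A B -> \rank A = \rank B.
Proof.
move=> [P [Q [PQ QP AP]]]; apply/eqP; rewrite eqn_leq; apply/andP; split.
  have -> : A = P *m B *m Q by rewrite -AP -mulmxA PQ mulmx1.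
  exact: leq_trans (mxrankM_maxl _ _) (mxrankM_maxr _ _).
have -> : B = Q *m A *m P by rewrite -mulmxA AP mulmxA QP mul1mx.
exact: leq_trans (mxrankM_maxl _ _) (mxrankM_maxr _ _).
Qed.

Lemma mx_sim_block n1 n2 m1 m2 (A1 : 'M[F]_n1) (A2 : 'M[F]_n2)
    (B1 : 'M[F]_m1) (B2 : 'M[F]_m2) :
  mx_sim A1 B1 -> mx_sim A2 B2 ->
  mx_sim (direct_sum_mx A1 A2) (direct_sum_mx B1 B2).
Proof.
move=> [P [Q [PQ QP AP]]] [S [T [ST TS BS]]].
exists (block_mx P 0 0 S), (block_mx Q 0 0 T).
rewrite /direct_sum_mx !mulmx_block !mulmx0 !mul0mx !addr0 !add0r.
by rewrite PQ QP ST TS AP BS -!scalar_mx_block.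
Qed.

Lemma mx_sim_block_assoc n1 n2 n3 (A1 : 'M[F]_n1) (A2 : 'M[F]_n2)
    (A3 : 'M[F]_n3) :
  mx_sim (direct_sum_mx A1 (direct_sum_mx A2 A3))
         (direct_sum_mx (direct_sum_mx A1 A2) A3).
Proof.
rewrite /direct_sum_mx.
have := @block_mxA F n1 n2 n3 n1 n2 n3 A1 0 0 0 A2 0 0 0 A3.
rewrite /= !row_mx0 !col_mx0 => ->.
exact: mx_sim_cast.
Qed.

Lemma mx_sim_block0 n (A : 'M[F]_n) (B : 'M[F]_0) :
  mx_sim (direct_sum_mx A B) A.
Proof.
exists (col_mx 1%:M 0), (row_mx 1%:M 0); split.
- rewrite mul_col_row mulmx1 mulmx0 !mul0mx scalar_mx_block.
  by congr block_mx; apply/matrixP => -[].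
- by rewrite mul_row_col mulmx1 mulmx0 addr0.
- by rewrite mul_block_col mul_col_mx !mul0mx mulmx0 !addr0 mulmx1 mul1mx.
Qed.

(** In a full rank factorization [A = E *m H], cancelling [E] on the left and [H] on the right of
    [E *m H *m E *m H = E *m H] leaves [H *m E = 1%:M]. This gives coordinates on the image of a
    projection. *)
Lemma idempotent_factor n (A : 'M[F]_n) : A *m A = A ->
  exists r (E : 'M[F]_(n, r)) (H : 'M[F]_(r, n)),
    E *m H = A /\ H *m E = 1%:M.
Proof.
move=> AA; exists (\rank A), (col_base A), (row_base A).
split; first exact: mulmx_base.
have cancel r (E : 'M_(n, r)) (H : 'M_(r, n)) C D :
    C *m E = 1%:M -> H *m D = 1%:M -> E *m H = A -> H *m E = 1%:M.
  move=> CE HD EH.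
  have : C *m (A *m A) *m D = C *m A *m D by rewrite AA.
  by rewrite -EH !mulmxA CE !mul1mx -!mulmxA HD mulmx1.
have /row_fullP[C CE] := col_base_full A.
have /row_freeP[D HD] := row_base_free A.
exact: cancel CE HD (mulmx_base A).
Qed.

(* The Krylov space of a vector of maximal height has the common kernel of the
   row vectors [f M^i] as an invariant complement. *)
Lemma nilp_split n (M : 'M[F]_n) s : (0 < n)%N -> M ^+ s = 0 ->
  exists m d (M' : 'M[F]_d),
    [/\ (0 < m)%N, forall t, M ^+ t = 0 -> (m <= t)%N,
        mx_sim M (direct_sum_mx (J m) M') & M' ^+ m = 0].
Proof.
move=> n0 Ms; have exM : exists s, M ^+ s == 0 by exists s; apply/eqP.
case: (ex_minnP exM) => m /eqP Mm minm {exM s Ms}.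
have m0 : (0 < m)%N.
  case: m Mm {minm} => // /matrixP/(_ (Ordinal n0) (Ordinal n0))/eqP.
  by rewrite expr0 !mxE eqxx oner_eq0.
have [p [q Mpq]] : exists p q, (M ^+ m.-1) p q != 0.
  have : M ^+ m.-1 != 0.
    by apply: contraL m0 => /minm; case: (m) => //= a; rewrite ltnn.
  by case/matrix0Pn => p [q pq]; exists p, q.
(* Column [j] is [M ^+ (m.-1 - j)] applied to the [q]-th unit vector, so column 0 lies in the kernel
   of [M]; [f] is the [p]-th coordinate, scaled to take the value 1 on column 0. *)
pose V : 'M[F]_(n, m) := \matrix_(i, j) (M ^+ (m.-1 - j)) i q.
pose f : 'rV[F]_n := ((M ^+ m.-1) p q)^-1 *: row p 1%:M.
have MV : M *m V = V *m J m.
  have MVE i j : (M *m V) i j = (M ^+ (m.-1 - j).+1) i q.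
    rewrite exprS -[M * _]/(M *m _) !mxE.
    by apply: eq_bigr => l _; rewrite mxE.
  apply/matrixP => i j; rewrite MVE.
  case: j => -[|j] jm.
    by rewrite mulmx_jordan0_first //= subn0 prednK // Mm mxE.
  rewrite (@mulmx_jordan0_succ _ _ _ _ _ (Ordinal (ltnW jm))) // mxE /=.
  by congr ((M ^+ _) _ _); lia.
have fV : (f *m V) 0 (Ordinal m0) = 1.
  by rewrite /f -scalemxAl -row_mul mul1mx !mxE subn0 mulVf.
have Gu := @jordan_chain_unit _ _ _ _ _ _ (Ordinal m0) MV erefl fV.
set F0 := \matrix_i _ in Gu; set G := F0 *m V in Gu.
have F0M : F0 *m M = J m *m F0.
  apply/row_matrixP => i; rewrite row_mul rowK -mulmxA.
  have -> : M ^+ i *m M = M ^+ i.+1 by rewrite exprSr.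
  apply/rowP => j; rewrite [RHS]mxE.
  have [im|im] := ltnP i.+1 m.
    by rewrite (@mul_jordan0mx_pred _ _ _ _ _ (Ordinal im)) // [RHS]mxE.
  have {}im : i.+1 = m by apply/eqP; rewrite eqn_leq im ltn_ord.
  by rewrite mul_jordan0mx_last // im Mm mulmx0 mxE.
(* Since [G] commutes with the Jordan block, normalizing [F0] by [invmx G] gives a left inverse [K]
   of [V] that still satisfies the intertwining relation of [F0]. *)
have GJ : invmx G *m J m = J m *m invmx G.
  have GJ : G *m J m = J m *m G by rewrite mulmxA -F0M -!mulmxA MV.
  by rewrite -[LHS](mulmxK Gu) -(mulmxA _ (J m)) -GJ mulKmx.
have [K [KV KM]] : exists K, K *m V = 1%:M /\ K *m M = J m *m K.
  by exists (invmx G *m F0); rewrite -mulmxA mulVmx // -mulmxA F0M !mulmxA GJ.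
(* [S] projects onto the kernel of [K], which is [M]-invariant, along the span of [V]; [E] and [H]
   are coordinates on this complement. *)
pose S := 1%:M - V *m K.
have SS : S *m S = S.
  rewrite {2}/S mulmxBr mulmx1 mulmxA {2}/S mulmxBl mul1mx.
  by rewrite -(mulmxA V) KV mulmx1 subrr mul0mx subr0.
have [d [E [H [EH HE]]]] := idempotent_factor SS.
have KE : K *m E = 0.
  rewrite -[LHS]mulmx1 -HE -mulmxA (mulmxA E) EH mulmxA /S mulmxBr mulmx1.
  by rewrite mulmxA KV mul1mx subrr mul0mx.
have HV : H *m V = 0.
  rewrite -[LHS]mul1mx -HE mulmxA -(mulmxA H) EH -mulmxA /S mulmxBl mul1mx.
  by rewrite -mulmxA KV mulmx1 subrr mulmx0.
have ME : M *m E = E *m (H *m M *m E).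
  rewrite !mulmxA EH /S mulmxBl mul1mx mulmxBl -(mulmxA V) KM.
  by rewrite -!mulmxA KE !mulmx0 subr0.
exists m, d, (H *m M *m E); split=> //.
- by move=> t /eqP /minm.
- exists (row_mx V E), (col_mx K H); split.
  + by rewrite mul_row_col EH addrC subrK.
  + by rewrite mul_col_row KV KE HV HE -scalar_mx_block.
  + by rewrite mul_mx_row mul_row_block !mulmx0 addr0 add0r MV ME.
- rewrite -[LHS]mul1mx -HE -mulmxA -(exprmx_intertwine m ME).
  by rewrite Mm mul0mx mulmx0.
Qed.

End Similarity.

(** * Jordan types from rank conditions *)

Section Ranks.
Variable F : fieldType.

Local Notation J m := (jordan_block m (0 : F)).

Lemma rank_factor1 m n (A : 'M[F]_(m, n)) :
  exists C D, C *m A *m D = 1%:M :> 'M_(\rank A).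
Proof.
have /row_fullP[C CE] := col_base_full A.
have /row_freeP[D HD] := row_base_free A.
have cancel r (E : 'M[F]_(m, r)) (H : 'M_(r, n)) C' D' :
    C' *m E = 1%:M -> H *m D' = 1%:M -> C' *m (E *m H) *m D' = 1%:M.
  by move=> CE' HD'; rewrite !mulmxA CE' mul1mx.
by exists C, D; have := cancel _ _ _ _ _ CE HD; rewrite mulmx_base.
Qed.

(** Compressing each diagonal block to an identity matrix of its rank leaves a unit upper triangular
    matrix, whatever [C] is. *)
Lemma rank_ublock_geq m n p q (A : 'M[F]_(m, n)) (B : 'M[F]_(p, q)) C :
  (\rank A + \rank B <= \rank (block_mx A C 0 B))%N.
Proof.
have [CA [DA CAD]] := rank_factor1 A; have [CB [DB CBD]] := rank_factor1 B.
pose S := block_mx CA 0 0 CB; pose T := block_mx DA 0 0 DB.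
have STu : S *m block_mx A C 0 B *m T \in unitmx.
  rewrite !mulmx_block !(mulmx0, mul0mx, addr0, add0r) CAD CBD.
  by rewrite unitmxE det_ublock !det1 mulr1 unitr1.
rewrite -(mxrank_unit STu).
exact: leq_trans (mxrankM_maxl _ _) (mxrankM_maxr _ _).
Qed.

(* [ker M] is contained in [im M], the image being tested through the row
   vectors that annihilate it. *)
Definition ker_in_im n (M : 'M[F]_n) : Prop :=
  forall (f : 'rV_n) (w : 'cV_n), f *m M = 0 -> M *m w = 0 -> f *m w = 0.

(** A left kernel vector is supported on the last coordinate and a right one on the first; these
    differ when [1 < m]. *)
Lemma ker_in_im_jordan m : (1 < m)%N -> ker_in_im (J m).
Proof.
move=> m1 f w fJ Jw; apply/matrixP => a b; rewrite !mxE big1 // => l _.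
have [l1|l1] := ltnP l.+1 m.
  have := @mulmx_jordan0_succ _ _ _ f a l (Ordinal l1) erefl.
  by rewrite fJ mxE => <-; rewrite mul0r.
have l0 : (l.-1 < m)%N by apply: leq_ltn_trans (leq_pred l) (ltn_ord l).
have ll : l = (Ordinal l0).+1 :> nat.
  by rewrite /= prednK // -ltnS (leq_trans m1).
have := mul_jordan0mx_pred w b ll.
by rewrite Jw mxE => <-; rewrite mulr0.
Qed.

Lemma ker_in_im_direct_sum m n (A : 'M[F]_m) (B : 'M[F]_n) :
  ker_in_im A -> ker_in_im B -> ker_in_im (direct_sum_mx A B).
Proof.
move=> hA hB f w; rewrite -(hsubmxK f) -(vsubmxK w) /direct_sum_mx.
rewrite mul_row_block mul_block_col !mulmx0 !mul0mx !addr0 !add0r.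
rewrite -row_mx0 -col_mx0 => /eq_row_mx[fA fB] /eq_col_mx[Aw Bw].
by rewrite mul_row_col hA ?hB ?addr0.
Qed.

Lemma ker_in_im_sim m n (A : 'M[F]_m) (B : 'M[F]_n) :
  mx_sim A B -> ker_in_im B -> ker_in_im A.
Proof.
move=> [P [Q [PQ QP AP]]] hB f w fA Aw.
have -> : f *m w = (f *m P) *m (Q *m w).
  by rewrite mulmxA -(mulmxA f) PQ mulmx1.
apply: hB; first by rewrite -mulmxA -AP mulmxA fA mul0mx.
have -> : B *m (Q *m w) = Q *m (A *m P) *m Q *m w.
  by rewrite AP !mulmxA QP mul1mx.
by rewrite -!mulmxA (mulmxA P) PQ mul1mx Aw mulmx0.
Qed.

Lemma rank_direct_sum_jordan m n (B : 'M[F]_n) : (0 < m)%N ->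
  \rank (direct_sum_mx (J m) B) = (m.-1 + \rank B)%N.
Proof. by move=> m0; rewrite rank_diag_block_mx rank_jordan0. Qed.

(** Blocks are split off in order of decreasing size. Each costs one unit of rank, so there are at
    most three; with exactly three the rank is [2 * k - 2], and the last hypothesis rules out that
    all of them have size at least 2. *)
Lemma nilp_jordan_types k (M : 'M[F]_(2 * k + 1)) :
  M ^+ (2 * k + 1) = 0 -> (2 * k <= \rank M + 2)%N ->
  ((\rank M + 2 <= 2 * k)%N -> ~ ker_in_im M) ->
  [\/ mx_sim M (J (2 * k + 1)),
      exists2 i : nat, (1 <= i <= k)%N &
        mx_sim M (direct_sum_mx (J (2 * k - i + 1)) (J i))
    | exists2 i : nat, (1 <= i <= k)%N &
        mx_sim M (direct_sum_mx (direct_sum_mx (J (2 * k - i)) (J i)) (J 1))].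
Proof.
move=> Mnil rM hM.
have [|m1 [d1 [M1 [m1_gt0 _ MM1 M1nil]]]] := nilp_split _ Mnil; first lia.
have dim1 := mx_sim_dim MM1.
case: d1 => [|d1] in M1 MM1 M1nil dim1.
  constructor 1; have := mx_sim_trans MM1 (mx_sim_block0 _ _).
  by have -> : m1 = (2 * k + 1)%N by lia.
have [|m2 [d2 [M2 [m2_gt0 minm2 MM2 M2nil]]]] := nilp_split _ M1nil => //.
(* The size of a block is the least exponent killing what was left before it was split off, so sizes
   decrease; this later bounds [m2] by [k]. *)
have m21 := minm2 _ M1nil.
have dim2 := mx_sim_dim MM2.
have {minm2}MM2 := mx_sim_trans MM1 (mx_sim_block (mx_sim_refl _) MM2).
case: d2 => [|d2] in M2 MM2 M2nil dim2.
  constructor 2; exists m2; first lia.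
  have -> : (2 * k - m2 + 1)%N = m1 by lia.
  exact: mx_sim_trans MM2 (mx_sim_block (mx_sim_refl _) (mx_sim_block0 _ _)).
have [|m3 [d3 [M3 [m3_gt0 minm3 MM3 M3nil]]]] := nilp_split _ M2nil => //.
have m32 := minm3 _ M2nil.
have dim3 := mx_sim_dim MM3.
have {minm3}MM3 := mx_sim_trans MM2 (mx_sim_block (mx_sim_refl _)
   (mx_sim_block (mx_sim_refl _) MM3)).
have rkM := mx_sim_rank MM3.
rewrite !rank_direct_sum_jordan // in rkM.
(* A nonempty remainder would lose a fourth unit of rank. *)
case: d3 => [|d3] in M3 MM3 M3nil dim3 rkM; last first.
  have := rank_nilp (ltn0Sn d3) M3nil; lia.
have r3 : \rank M3 = 0%N by apply/eqP; rewrite -leqn0 rank_leq_row.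
have {}MM3 := mx_sim_trans MM3 (mx_sim_block (mx_sim_refl _)
   (mx_sim_block (mx_sim_refl _) (mx_sim_block0 _ _))).
have m3E : m3 = 1%N.
  apply/eqP; rewrite eqn_leq m3_gt0 andbT leqNgt; apply/negP => m3_gt1.
  apply: hM; first lia.
  apply: ker_in_im_sim MM3 _.
  by do 2?apply: ker_in_im_direct_sum; apply: ker_in_im_jordan; lia.
constructor 3; exists m2; first lia.
have -> : (2 * k - m2)%N = m1 by lia.
rewrite m3E in MM3.
exact: mx_sim_trans MM3 (mx_sim_block_assoc _ _ _).
Qed.

(** Multiplying [M] by [col_mx R U] on the left and [row_mx W L] on the right yields a block upper
    triangular matrix with diagonal blocks [X] and [(J k)^T]. The choice [W = V] gives the bound
    [2 * k - 2]; adjoining a column to [V] can improve it. *)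
Lemma rank_bordered_geq n k q (M : 'M[F]_n) (W : 'M[F]_(n, q))
    (X : 'M[F]_(k, q)) (R U : 'M[F]_(k, n)) (V L : 'M[F]_(n, k)) :
  (0 < k)%N -> M *m W = V *m X -> U *m M = (J k)^T *m U ->
  R *m V = 1%:M -> U *m V = 0 -> U *m L = 1%:M ->
  (\rank X + k.-1 <= \rank M)%N.
Proof.
move=> k0 MW UM RV UV UL.
have E : col_mx R U *m M *m row_mx W L = block_mx X (R *m M *m L) 0 (J k)^T.
  rewrite mul_col_mx mul_col_row -!mulmxA MW; congr block_mx.
  - by rewrite mulmxA RV mul1mx.
  - by rewrite mulmxA UV mul0mx.
  - by rewrite mulmxA UM -mulmxA UL mulmx1.
rewrite -(rank_jordan0 F k0) -(mxrank_tr (J k)).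
apply: leq_trans (rank_ublock_geq X _ (R *m M *m L)) _; rewrite -E.
exact: leq_trans (mxrankM_maxl _ _) (mxrankM_maxr _ _).
Qed.

(** If [x = J k *m c], then [v - V *m c] is a kernel vector. Otherwise adjoining the column [x] to
    [J k] raises its rank to [k], and [M] would have rank at least [2 * k - 1]. The transposes
    express column spaces as row spaces. *)
Lemma ker_correction n k (M : 'M[F]_n) (R U : 'M[F]_(k, n))
    (V L : 'M[F]_(n, k)) (v : 'cV[F]_n) (x : 'cV[F]_k) :
  (0 < k)%N -> M *m V = V *m J k -> U *m M = (J k)^T *m U ->
  R *m V = 1%:M -> U *m V = 0 -> U *m L = 1%:M ->
  M *m v = V *m x -> (\rank M + 2 <= 2 * k)%N ->
  exists c, M *m (v - V *m c) = 0.
Proof.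
move=> k0 MV UM RV UV UL Mv rM.
have [/submxP[D xD]|xJ] := boolP (x^T <= (J k)^T)%MS.
  exists D^T; rewrite mulmxBr mulmxA MV Mv -mulmxA.
  by rewrite -[x]trmxK xD trmx_mul trmxK subrr.
have MW : M *m row_mx V v = V *m row_mx (J k) x.
  by rewrite !mul_mx_row MV Mv.
have := rank_bordered_geq k0 MW UM RV UV UL.
have : (\rank (J k) < \rank (row_mx (J k) x))%N.
  rewrite -[X in (X < _)%N]mxrank_tr -[X in (_ < X)%N]mxrank_tr tr_row_mx.
  rewrite -addsmxE; apply: rank_ltmx; rewrite ltmxE addsmxSl /=.
  by apply: contra xJ; apply: submx_trans; apply: addsmxSr.
rewrite rank_jordan0 //; lia.
Qed.

Lemma trmx_expr n (A : 'M[F]_n) s : A^T ^+ s = (A ^+ s)^T.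
Proof.
elim: s => [|s IHs]; first by rewrite !expr0 trmx1.
by rewrite exprS exprSr IHs -[RHS]/((_ *m _)^T) trmx_mul.
Qed.

(** The vectors [x] and [y] record that [M] sends [v] into the span of [V], and [r] into the row
    space of [U]; the duality relations make [M] block triangular with diagonal blocks [J k], [0]
    and [(J k)^T]. *)
Lemma bordered_jordan_types k (M : 'M[F]_(2 * k + 1))
    (R U : 'M[F]_(k, 2 * k + 1)) (V L : 'M[F]_(2 * k + 1, k))
    (v : 'cV[F]_(2 * k + 1)) (r : 'rV[F]_(2 * k + 1))
    (x : 'cV[F]_k) (y : 'rV[F]_k) :
  (0 < k)%N -> M *m V = V *m J k -> U *m M = (J k)^T *m U ->
  M *m v = V *m x -> r *m M = y *m U ->
  R *m V = 1%:M -> U *m L = 1%:M -> r *m v = 1%:M ->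
  U *m V = 0 -> U *m v = 0 -> r *m V = 0 ->
  [\/ mx_sim M (J (2 * k + 1)),
      exists2 i : nat, (1 <= i <= k)%N &
        mx_sim M (direct_sum_mx (J (2 * k - i + 1)) (J i))
    | exists2 i : nat, (1 <= i <= k)%N &
        mx_sim M (direct_sum_mx (direct_sum_mx (J (2 * k - i)) (J i)) (J 1))].
Proof.
move=> k0 MV UM Mv rM RV UL rv UV Uv rV.
apply: nilp_jordan_types.
(* Nilpotency: [M ^+ k] maps into the kernel of [U], which is the span of [V] and [v]; one more [M]
   maps that into the span of [V], and a further [M ^+ k] kills it. *)
- have UMk : U *m M ^+ k = 0.
    by rewrite -(exprmx_intertwine k (esym UM)) trmx_expr jordan_block0_nilp
      trmx0 mul0mx.
  pose W := row_mx V v.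
  have rW : (k + 1 <= \rank W)%N.
    have SW : col_mx R r *m W \in unitmx.
      by rewrite mul_col_row RV rv rV unitmxE det_ublock !det1 mulr1 unitr1.
    by rewrite -[X in (X <= _)%N](mxrank_unit SW) mxrankM_maxr.
  have rU : (k <= \rank U)%N.
    by rewrite -[X in (X <= _)%N](mxrank1 F k) -UL mxrankM_maxl.
  have WU : (W^T <= kermx U^T)%MS.
    by apply/sub_kermxP; rewrite -trmx_mul mul_mx_row UV Uv row_mx0 trmx0.
  (* Equality by dimensions: [W] has rank at least [k + 1], and the kernel of [U] has dimension at
     most [2 * k + 1 - k]. *)
  have UW : (kermx U^T <= W^T)%MS.
    rewrite -(mxrank_leqif_sup WU) eqn_leq mxrankS //= mxrank_ker !mxrank_tr.
    lia.
  have /submxP[D MkD] : ((M ^+ k)^T <= W^T)%MS.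
    apply: submx_trans UW; apply/sub_kermxP.
    by rewrite -trmx_mul UMk trmx0.
  have {}MkD : M ^+ k = W *m D^T.
    by apply: trmx_inj; rewrite MkD trmx_mul trmxK.
  have MkV : M ^+ k *m V = 0.
    by rewrite (exprmx_intertwine k MV) jordan_block0_nilp mulmx0.
  have MX s : s = (k.+1 + k)%N -> M ^+ s = M *m M ^+ k *m M ^+ k.
    by move=> ->; rewrite exprD exprS.
  rewrite MX; last lia.
  rewrite [X in _ *m X]MkD mulmxA exprmx_comm -(mulmxA _ M) mul_mx_row MV Mv.
  by rewrite mul_mx_row !mulmxA MkV !mul0mx row_mx0 mul0mx.
- have := rank_bordered_geq k0 MV UM RV UV UL.
  rewrite rank_jordan0 //; lia.
- move=> rkM kerM.
  have [c Mc] := ker_correction k0 MV UM RV UV UL Mv rkM.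
  (* Transposition exchanges [V] with [U^T] and [R] with [L^T], so the same correction applies to
     [r]. *)
  have [d Md] : exists d : 'cV_k, M^T *m (r^T - U^T *m d) = 0.
    apply: (@ker_correction _ _ M^T L^T V^T U^T R^T _ y^T) => //.
    + by rewrite -trmx_mul UM trmx_mul trmxK.
    + by rewrite -trmx_mul MV trmx_mul.
    + by rewrite -trmx_mul UL trmx1.
    + by rewrite -trmx_mul UV trmx0.
    + by rewrite -trmx_mul RV trmx1.
    + by rewrite -!trmx_mul rM.
    + by rewrite mxrank_tr.
  have fM : (r - d^T *m U) *m M = 0.
    by apply: trmx_inj; rewrite trmx_mul linearB /= trmx_mul trmxK Md trmx0.
  (* The corrections pair to zero with everything, so the product of the two kernel vectors is still
     [r *m v = 1%:M]. *)
  have := kerM _ _ fM Mc.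
  rewrite mulmxBl !mulmxBr !mulmxA rv rV mul0mx subr0 -!mulmxA Uv (mulmxA U) UV.
  rewrite mul0mx !mulmx0 !subr0 => /matrixP/(_ 0 0)/eqP.
  by rewrite !mxE eqxx oner_eq0.
Qed.

End Ranks.

(** * Pairing of left and right Jordan chains *)

Section Deflation.
Variable F : fieldType.

Local Notation J m := (jordan_block m (0 : F)).

Definition mx_of_rows n k (p : nat -> 'rV[F]_n) : 'M[F]_(k, n) :=
  \matrix_(i < k) p i.+1.

Lemma mulmx_columns m n k (A : 'M[F]_(m, n)) (w : nat -> 'cV[F]_n) :
  A *m mx_of_columns k w = mx_of_columns k (fun i => A *m w i).
Proof.
by apply/matrixP => i j; rewrite !mxE; apply: eq_bigr => l _; rewrite mxE.
Qed.

Lemma col_mx_of_columns n k (w : nat -> 'cV[F]_n) (j : 'I_k) :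
  col j (mx_of_columns k w) = w j.+1.
Proof. by apply/colP => i; rewrite !mxE. Qed.

Lemma mulmx_columns0 m n k (A : 'M[F]_(m, n)) (w : nat -> 'cV[F]_n) :
  (forall j, (1 <= j <= k)%N -> A *m w j = 0) -> A *m mx_of_columns k w = 0.
Proof.
move=> Aw; rewrite mulmx_columns; apply/matrixP => i j.
by rewrite mxE Aw ?ltn_ord ?mxE.
Qed.

Lemma nilp_chain_columns n k (N : 'M[F]_n) (v : nat -> 'cV[F]_n) :
  N *m v 1%N = 0 -> (forall i, (1 <= i < k)%N -> N *m v i.+1 = v i) ->
  N *m mx_of_columns k v = mx_of_columns k v *m J k.
Proof.
move=> Nv1 Nv; rewrite mulmx_columns; apply/matrixP => i j; rewrite mxE.
case: j => -[|j] jk /=; first by rewrite mulmx_jordan0_first // Nv1 mxE.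
by rewrite (@mulmx_jordan0_succ _ _ _ _ _ (Ordinal (ltnW jk))) // Nv // mxE.
Qed.

Lemma nilp_chain_rows n k (N : 'M[F]_n) (p : nat -> 'rV[F]_n) :
  p 1%N *m N = 0 -> (forall i, (1 <= i < k)%N -> p i.+1 *m N = p i) ->
  mx_of_rows k p *m N = (J k)^T *m mx_of_rows k p.
Proof.
move=> p1N pN; have rowsE : mx_of_rows k p = (mx_of_columns k (trmx \o p))^T.
  by apply/matrixP => i j; rewrite !mxE.
rewrite rowsE -{1}[N]trmxK -!trmx_mul; congr (_^T).
apply: nilp_chain_columns; first by rewrite -trmx_mul p1N trmx0.
by move=> i ik; rewrite -trmx_mul pN.
Qed.

Section Pairing.
Variables (n : nat) (N : 'M[F]_n) (p : nat -> 'rV[F]_n) (v : nat -> 'cV[F]_n).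
Hypotheses (p1N : p 1%N *m N = 0)
  (pN : forall i, (1 <= i < n)%N -> p i.+1 *m N = p i)
  (Nv1 : N *m v 1%N = 0)
  (Nv : forall i, (1 <= i < n)%N -> N *m v i.+1 = v i).

(** Writing [v j = N *m v j.+1] and moving [N] to the left turns [p i *m v j] into
    [p i.-1 *m v j.+1]; repeating this ends with [p 1%N *m N = 0]. *)
Lemma chain_pairing0 i j : (0 < i)%N -> (0 < j)%N -> (i + j <= n)%N ->
  p i *m v j = 0.
Proof.
move=> i0 j0; elim: i i0 j j0 => // -[|i] IH _ j j0 ijn.
  by rewrite -(Nv (i := j)) ?mulmxA ?p1N ?mul0mx //; lia.
by rewrite -(Nv (i := j)) ?mulmxA ?pN ?IH //; lia.
Qed.

(** The same shift, now stopping at the pair of [p 1%N] and [v n]. *)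
Lemma chain_pairing_antidiag i j : (0 < i)%N -> (0 < j)%N ->
  (i + j = n.+1)%N -> p i *m v j = p 1%N *m v n.
Proof.
move=> i0 j0; elim: i i0 j j0 => // -[|i] IH _ j j0 ijn.
  by congr (_ *m v _); lia.
by rewrite -(Nv (i := j)) ?mulmxA ?pN ?IH //; lia.
Qed.

(** Otherwise [p 1%N] would annihilate every [v j]; since the full chain is a basis, it would be
    zero. *)
Lemma chain_pairing_neq0 : p 1%N != 0 -> v 1%N != 0 -> p 1%N *m v n != 0.
Proof.
move=> p1 v1; apply: contra p1 => /eqP p1vn.
have [n0|n0] := posnP n; first by apply/eqP/rowP => i; have := ltn_ord i; lia.
have [f fv] : exists f : 'rV_n, f *m v 1%N = 1%:M.
  have /row_fullP[f fv] : row_full (v 1%N).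
    by rewrite /row_full -mxrank_tr rank_rV trmx_eq0 v1.
  by exists f.
have fW : (f *m mx_of_columns n v) 0 (Ordinal n0) = 1.
  by rewrite mulmx_columns mxE /= fv mxE eqxx.
(* Here both factors of the invertible product are square, so the matrix of the chain is itself
   invertible. *)
have := @jordan_chain_unit _ _ _ _ _ _ (Ordinal n0)
  (nilp_chain_columns Nv1 Nv) erefl fW.
rewrite unitmx_mul => /andP[_ Wu]; apply/eqP.
rewrite -[LHS](mulmxK Wu) mulmx_columns0 ?mul0mx // => j /andP[j0 jn].
have [jlt|jge] := ltnP j n; first by rewrite chain_pairing0.
by have -> : j = n by lia.
Qed.

End Pairing.

(** The bracket multiplied by [c] vanishes on the columns of [V] and, from the left, on the rows of
    [U]; so [M] acts there as [N] does, and the bordered form applies. With the rows [p i] in place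
    of conjugate transposes, any field will do. *)
Lemma deflation_jordan_types k (N : 'M[F]_(2 * k + 1)) c
    (p : nat -> 'rV[F]_(2 * k + 1)) (v : nat -> 'cV[F]_(2 * k + 1))
    (R : 'M[F]_(k, 2 * k + 1)) (L : 'M[F]_(2 * k + 1, k)) :
  let n := (2 * k + 1)%N in
  let V := mx_of_columns k v in
  let U := mx_of_rows k p in
  let r := ((p k.+1 *m v k.+1) 0 0)^-1 *: p k.+1 in
  let M := N + c *: (V *m R + v k.+1 *m r + L *m U - 1%:M) in
  (0 < k)%N -> p 1%N != 0 -> v 1%N != 0 ->
  p 1%N *m N = 0 -> (forall i, (1 <= i < n)%N -> p i.+1 *m N = p i) ->
  N *m v 1%N = 0 -> (forall i, (1 <= i < n)%N -> N *m v i.+1 = v i) ->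
  R *m V = 1%:M -> U *m L = 1%:M ->
  [\/ mx_sim M (J (2 * k + 1)),
      exists2 i : nat, (1 <= i <= k)%N &
        mx_sim M (direct_sum_mx (J (2 * k - i + 1)) (J i))
    | exists2 i : nat, (1 <= i <= k)%N &
        mx_sim M (direct_sum_mx (direct_sum_mx (J (2 * k - i)) (J i)) (J 1))].
Proof.
move=> n V U r M k0 p1 v1 p1N pN Nv1 Nv RV UL.
have pv0 := chain_pairing0 p1N pN Nv.
have pvn : (p k.+1 *m v k.+1) 0 0 != 0.
  rewrite (chain_pairing_antidiag pN Nv) //; last by rewrite /n; lia.
  apply: contra (chain_pairing_neq0 p1N pN Nv1 Nv p1 v1) => /eqP pv.
  by apply/eqP/matrixP => a b; rewrite !ord1 pv mxE.
have pV i : (1 <= i <= k.+1)%N -> p i *m V = 0.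
  by move=> ik; apply: mulmx_columns0 => j jk; apply: pv0; rewrite /n; lia.
have UE q (X : 'M_(_, q)) : (forall i, (1 <= i <= k)%N -> p i *m X = 0) ->
    U *m X = 0.
  move=> pX; apply/row_matrixP => i; rewrite row_mul rowK row0 pX //.
  by rewrite ltn_ord.
have UV : U *m V = 0 by apply: UE => i ik; apply: pV; lia.
have Uv : U *m v k.+1 = 0 by apply: UE => i ik; apply: pv0; rewrite /n; lia.
have rV : r *m V = 0 by rewrite -scalemxAl pV ?scaler0 // leqnn.
have rv : r *m v k.+1 = 1%:M.
  rewrite -scalemxAl; apply/matrixP => a b.
  by rewrite !ord1 [LHS]mxE mulVf // mxE eqxx.
(* [N] sends [v k.+1] to [v k], the last column of [V], whose index is [k.-1] when counted from 0;
   likewise for [p k.+1] and the last row of [U]. *)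
have k1 : (k.-1 < k)%N by rewrite prednK.
have k1E : (Ordinal k1).+1 = k by rewrite /= prednK.
have NV : N *m V = V *m J k.
  by apply: nilp_chain_columns Nv1 _ => i ik; apply: Nv; rewrite /n; lia.
have UN : U *m N = (J k)^T *m U.
  by apply: nilp_chain_rows p1N _ => i ik; apply: pN; rewrite /n; lia.
have Nvk : N *m v k.+1 = V *m delta_mx (Ordinal k1) 0.
  by rewrite -colE col_mx_of_columns k1E Nv // /n; lia.
have rN : r *m N =
    (((p k.+1 *m v k.+1) 0 0)^-1 *: delta_mx 0 (Ordinal k1)) *m U.
  by rewrite -!scalemxAl -rowE rowK k1E pN // /n; lia.
clearbody r U V.
(* On [v k.+1] the bracket leaves only [V *m R *m v k.+1], as the terms [v k.+1] cancel; from the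
   left, [r] leaves only [r *m L *m U]. Hence the summands scaled by [c]. *)
apply: (@bordered_jordan_types F k M R U V L (v k.+1) r
  (delta_mx (Ordinal k1) 0 + c *: (R *m v k.+1))
  (((p k.+1 *m v k.+1) 0 0)^-1 *: delta_mx 0 (Ordinal k1) + c *: (r *m L)))
  => //; rewrite /M.
- rewrite mulmxDl NV -scalemxAl mulmxBl !mulmxDl -!mulmxA RV rV UV.
  by rewrite !mulmx0 !addr0 mulmx1 mul1mx subrr scaler0 addr0.
- rewrite mulmxDr UN -scalemxAr mulmxBr !mulmxDr !mulmxA UV Uv UL.
  by rewrite !mul0mx !add0r mulmx1 mul1mx subrr scaler0 addr0.
- rewrite mulmxDl Nvk mulmxDr; congr (_ + _).
  rewrite -scalemxAl -scalemxAr mulmxBl !mulmxDl -!mulmxA rv Uv mulmx0 addr0.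
  by rewrite mulmx1 mul1mx addrK.
- rewrite mulmxDr rN mulmxDl; congr (_ + _).
  rewrite -scalemxAr -[in RHS]scalemxAl mulmxBr !mulmxDr !mulmxA rv rV mul0mx.
  by rewrite add0r mul1mx mulmx1 addrC addKr.
Qed.

End Deflation.

(** * Return to the complex chains and to the eigenvalue [lambda1] *)

Lemma direct_sum_addM (F : fieldType) m n (A : 'M[F]_m) (B : 'M[F]_n) a :
  direct_sum_mx A B + a%:M = direct_sum_mx (A + a%:M) (B + a%:M).
Proof. by rewrite [in LHS]scalar_mx_block add_block_mx !addr0. Qed.

Theorem theorem4p2 (R : realType) (k : nat) (hk : (1 <= k)%N)
    (A : 'M[R[i]]_(2 * k + 1)) (lambda0 lambda1 : R[i])
    (hA : is_similar_mx A (jordan_block (2 * k + 1) lambda0))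
    (u v : nat -> 'cV[R[i]]_(2 * k + 1))
    (hu : left_jordan_chain A lambda0 (2 * k + 1) u)
    (hv : right_jordan_chain A lambda0 (2 * k + 1) v)
    (Rm Lm : 'M[R[i]]_(2 * k + 1, k)) :
  let U := mx_of_columns k u in
  let V := mx_of_columns k v in
  let r := (((v k.+1)^t* *m u k.+1) 0 0)^-1 *: u k.+1 in
  Rm^t* *m V = 1%:M ->
  U^t* *m Lm = 1%:M ->
  let Ahat := A + (lambda1 - lambda0) *:
                (V *m Rm^t* + v k.+1 *m r^t* + Lm *m U^t*) in
  [\/ is_similar_mx Ahat (jordan_block (2 * k + 1) lambda1),
      exists2 i : nat, (1 <= i <= k)%N &
        is_similar_mx Ahat
          (direct_sum_mx (jordan_block (2 * k - i + 1) lambda1)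
                         (jordan_block i lambda1))
    | exists2 i : nat, (1 <= i <= k)%N &
        is_similar_mx Ahat
          (direct_sum_mx (direct_sum_mx (jordan_block (2 * k - i) lambda1)
                                        (jordan_block i lambda1))
                         (jordan_block 1 lambda1))].
Proof.
move: hu hv => [u1 u1A uA] [v1 Av1 Av] U V r RV UL Ahat.
pose p i : 'rV_(2 * k + 1) := (u i)^t*.
pose N := A - lambda0%:M.
have UE : U^t* = mx_of_rows k p by apply/matrixP => i j; rewrite !mxE.
(* Conjugating the normalizing scalar swaps the two factors of the inner product of [v k.+1] and
   [u k.+1]. *)
have rE : r^t* = ((p k.+1 *m v k.+1) 0 0)^-1 *: p k.+1.
  apply/rowP => j; rewrite !mxE rmorphM fmorphV rmorph_sum.
  congr (_^-1 * _); apply: eq_bigr => i _.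
  by rewrite !mxE rmorphM /= conjCK mulrC.
(* Passing from the shift by [lambda0] to the shift by [lambda1] is absorbed in the [- 1%:M] of the
   bracket. *)
have AhatE : Ahat = N + (lambda1 - lambda0) *:
    (V *m Rm^t* + v k.+1 *m r^t* + Lm *m U^t* - 1%:M) + lambda1%:M.
  rewrite /Ahat /N scalerBr scalemx1 raddfB /= opprB.
  by rewrite !addrA subrK addrAC subrK.
have k0 : (0 < k)%N by exact: hk.
have p1 : p 1%N != 0.
  apply: contra u1 => /eqP p1; rewrite -[u 1%N]trmxCK.
  by have -> : (u 1%N)^t* = 0 by []; rewrite trmx0 map_mx0.
have p1N : p 1%N *m N = 0 by rewrite mulmxBr mul_mx_scalar u1A subrr.
have pN i : (1 <= i < 2 * k + 1)%N -> p i.+1 *m N = p i.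
  by move=> ik; rewrite mulmxBr mul_mx_scalar uA // addrC addKr.
have Nv1 : N *m v 1%N = 0 by rewrite mulmxBl mul_scalar_mx Av1 subrr.
have Nv i : (1 <= i < 2 * k + 1)%N -> N *m v i.+1 = v i.
  by move=> ik; rewrite mulmxBl mul_scalar_mx Av // addrC addKr.
rewrite UE in UL.
have := deflation_jordan_types (lambda1 - lambda0) k0 p1 v1 p1N pN Nv1 Nv RV UL.
rewrite -rE -UE AhatE; set M := N + _.
have jordanE m := esym (jordan_blockE m lambda1).
case=> [sim|[i ik sim]|[i ik sim]].
- constructor 1; have := mx_sim_is_similar (mx_sim_addM lambda1 sim).
  by rewrite jordanE.
- constructor 2; exists i => //.
  have := mx_sim_is_similar (mx_sim_addM lambda1 sim).
  by rewrite direct_sum_addM !jordanE.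
- constructor 3; exists i => //.
  have := mx_sim_is_similar (mx_sim_addM lambda1 sim).
  by rewrite !direct_sum_addM !jordanE.
Qed.
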